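(* Let $\{K_i\}_{i\in I}$ be a family of compact spaces and let $\beta\bigcup_{i\in I}K_i$ be the Čech–Stone compactification of their discrete union. Then $$\mathfrak{r}\Big(\beta\bigcup_{i\in I}K_i\Big)=\min\{\mathfrak{r}(K_i): i\in I\}$$ and, therefore, $$\mathfrak{Dau}\left(\Big(\bigoplus_{i\in I}C(K_i)\Big)_{\ell_\infty}\right)=\min_{i\in I}\mathfrak{Dau}(C(K_i)).$$
   Context: All topological spaces are Hausdorff and all Banach spaces are real; $C(K)$ is the space of real continuous functions on $K$ with the sup norm. The discrete union is the topological disjoint sum. $\big(\bigoplus_{i\in I}X_i\big)_{\ell_\infty}$ denotes the $\ell_\infty$-sum of Banach spaces. The reaping number $\mathfrak{r}(K)$ of a compact space $K$ is the least cardinality of a family $\mathcal{F}$ of nonempty open subsets of $K$ such that for every two disjoint closed sets $L_1,L_2\subseteq K$ there exists $W\in\mathcal{F}$ with $W\cap L_1=\emptyset$ or $W\cap L_2=\emptyset$. $B_X$ and $S_X$ denote the closed unit ball and unit sphere of a Banach space $X$. A slice of $B_X$ is a nonempty intersection of $B_X$ with an open half-space, i.e. a set $\{x\in B_X: f(x)>\sup f(B_X)-\alpha\}$ with $f\in X^*$, $\alpha>0$. For a cardinal $\kappa$, $\{y_\alpha:\alpha<\kappa\}$ denotes a set of cardinality at most $\kappa$. $X$ has the $\kappa$-Daugavet property if for every family $\{y_\alpha:\alpha<\kappa\}\subseteq S_X$, every slice $S$ of $B_X$ and every $\varepsilon>0$ there is $x\in S$ with $\|y_\alpha+x\|>2-\varepsilon$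 for all $\alpha<\kappa$. For nonzero $X$, $\mathfrak{Dau}(X)$ is the least cardinal $\kappa$ such that $X$ fails the $\kappa$-Daugavet property. *)

(* Defs.v *)
From HB Require Import structures.
From mathcomp Require Import all_boot all_order all_algebra lra.
From mathcomp Require Import all_classical all_reals all_analysis.
Set Implicit Arguments.
Unset Strict Implicit.
Unset Printing Implicit Defensive.
Import Order.TTheory GRing.Theory Num.Theory.
Import numFieldNormedType.Exports.
Local Open Scope classical_set_scope.
Local Open Scope ring_scope.
Local Open Scope card_scope.

(* A cardinal number is represented by the class of all types of that
   cardinality, so that Leibniz equality of classes is equality of cardinals.
   The empty class represents no cardinal at all: it is the value of the least
   cardinal with a property that no cardinal has, and only then
   (exists_least_card). *)
Definition cardinal := Type -> Prop.

(* To be used with properties that are invariant under equipotence. *)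
Definition least_card (P : Type -> Prop) : cardinal :=
  fun k => P k /\ forall k', P k' -> [set: k] #<= [set: k'].

Definition min_card (I : Type) (c : I -> cardinal) : cardinal :=
  least_card (fun k => exists i, c i k).

(* Among the subsets of the product of a family of types on which every
   projection is injective, a maximal one projects onto some factor. *)
Lemma exists_least_type (J : Type) (A : J -> Type) (j0 : J) :
  exists j, forall j', [set: A j] #<= [set: A j'].
Proof.
pose inj (S : set (forall j, A j)) :=
  forall j x y, S x -> S y -> x j = y j -> x = y.
have [S [injS maxS]] : exists S, inj S /\ forall T, S `<` T -> ~ inj T.
  apply: Zorn_bigcup => F Finj Ftot j x y [X FX Xx] [Y FY Yy] xy.
  have [XY|YX] := Ftot _ _ FX FY.
    by apply: (Finj _ FY j) => //; exact: XY.
  by apply: (Finj _ FX j) => //; exact: YX.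
have [[j Sj]|nS] := pselect (exists j, forall a : A j, exists2 x, S x & x j = a).
  exists j => j'.
  have [g gP] : exists g : A j -> forall j, A j, forall a, S (g a) /\ g a j = a.
    have /choice[g gP] a : exists x, S x /\ x j = a.
      by have [x Sx xa] := Sj a; exists x.
    by exists g.
  have f_inj : set_inj [set: A j] (fun a => g a j').
    move=> a b _ _ /= ab; have [[Sa <-] [Sb <-]] := (gP a, gP b).
    by rewrite (injS j' _ _ Sa Sb ab).
  have [f] : $|{injfun [set: A j] >-> [set: A j']}|.
    by apply/injfunPex; exists (fun a => g a j').
  exact: inj_card_le f.
have [z zP] : {z : forall j, A j | forall j x, S x -> x j <> z j}.
  suff /all_sig[z zP] : forall j, {a : A j | forall x, S x -> x j <> a}.
    by exists z.
  move=> j; apply/cid; apply/not_existsP => h; apply: nS; exists j => a.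
  apply/not_exists2P => na; apply: (h a) => x Sx xa.
  by case: (na x).
case: (maxS (S `|` [set z])).
  split=> [|zS]; first exact: subsetUl.
  exact: (zP j0 z (zS z (or_intror erefl))).
move=> j x y [Sx|->] [Sy|->] //; first exact: injS.
- by move=> xz; case: (zP j x).
- by move=> xz; case: (zP j y).
Qed.

Lemma exists_least_card (P : Type -> Prop) :
  (forall k k', [set: k] #= [set: k'] -> P k -> P k') ->
  (exists k, P k) -> exists k, least_card P k.
Proof.
move=> Pinv [k0 Pk0].
have cardT (A : set k0) : [set: set_type A] #= A := card_setT A.
have PT : P (set_type [set: k0]) by apply: Pinv Pk0; exact: card_esym (cardT _).
have [[A PA] Amin] := @exists_least_type {A : set k0 | P (set_type A)}
  (fun A => set_type (sval A)) (exist _ [set: k0] PT).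
exists (set_type A); split=> // k Pk.
have [[] kmin] := @exists_least_type bool (fun b => if b then k0 else k) true.
  apply: card_le_trans (kmin false); rewrite (card_le_eql (cardT A)).
  exact: card_leT.
have /card_leP[f] := kmin true.
pose g (x : k) := val (f (to_setT x)).
have g_inj : injective g.
  move=> x y /val_inj fxy; apply: (congr1 val (x := to_setT x) (y := to_setT y)).
  by apply: ('inj_f) fxy; exact: in_setT.
pose B := range g.
have kB : [set: k] #= B.
  by apply: card_esym; apply: inj_card_eq => x y _ _; exact: g_inj.
have PB : P (set_type B).
  by apply: Pinv Pk; rewrite (card_eqr (cardT B)).
by have := Amin (exist _ B PB); rewrite /= (card_le_eqr (cardT B)) (card_le_eqr (card_esym kB)).
Qed.

Section reaping.
Context (K : topologicalType).

Definition reaping_family (F : set (set K)) :=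
  (forall W, F W -> open W /\ W !=set0) /\
  (forall L1 L2 : set K, closed L1 -> closed L2 -> L1 `&` L2 = set0 ->
     exists2 W, F W & W `&` L1 = set0 \/ W `&` L2 = set0).

Definition reaping_number : cardinal :=
  least_card (fun k =>
    exists2 F : set (set K), reaping_family F & F #= [set: k]).

Lemma exists_reaping_number (x : K) : exists k, reaping_number k.
Proof.
pose F : set (set K) := [set W | open W /\ W !=set0].
apply: exists_least_card => [k k' kk' [G rG Gk]|].
  by exists G => //; rewrite -(card_eqr kk').
exists (set_type F); exists F; last exact/card_esym/card_setT.
split=> // L1 L2 cL1 cL2 L12.
have [L1x|nL1x] := pselect (L1 x).
  exists (~` L2); last by right; exact: setICl.
  split; [exact: closed_openC | exists x => L2x].
  by have : (L1 `&` L2) x by []; rewrite L12.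
exists (~` L1); last by left; exact: setICl.
by split; [exact: closed_openC | exists x].
Qed.

End reaping.

Section daugavet.
Context (R : realType) (X : normedModType R).

Definition unit_ball : set X := [set x | `|x| <= 1].
Definition unit_sphere : set X := [set x | `|x| = 1].

Definition slice (f : X -> R) (a : R) : set X :=
  [set x | unit_ball x /\ sup (f @` unit_ball) - a < f x].

(* The k-Daugavet property, for the cardinality of the type k. *)
Definition daugavet_property (k : Type) :=
  forall Y : set X, Y `<=` unit_sphere -> Y #<= [set: k] ->
  forall f : {linear X -> R^o}, continuous f ->
  forall a e : R, 0 < a -> 0 < e ->
  exists2 x, slice f a x & forall y, Y y -> 2 - e < `|y + x|.

Definition daugavet_number : cardinal :=
  least_card (fun k => ~ daugavet_property k).

Lemma exists_daugavet_number (x : X) : x != 0 -> exists k, daugavet_number k.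
Proof.
move=> x0; apply: exists_least_card => [k k' kk' ndX dX|].
  by apply: ndX => Y Y1 Yk; apply: dX => //; rewrite -(card_le_eqr kk').
exists (set_type unit_sphere) => dX.
have f_cont : continuous ((\0 : {linear X -> R^o}) : X -> R^o).
  by move=> y; exact: cst_continuous.
have [||y [y1 _] yP] := dX unit_sphere _ _ _ f_cont 1 1 ltr01 ltr01 => //.
  by rewrite (card_le_eqr (card_setT unit_sphere)) card_lexx.
have nrm (z : X) : z != 0 -> unit_sphere (`|z|^-1 *: z).
  by move=> z0; rewrite /unit_sphere/= normrZ normfV normr_id mulVf ?normr_eq0.
have [y0|y0] := eqVneq y 0.
  have := yP _ (nrm _ x0); rewrite y0 addr0 (nrm _ x0).
  by rewrite [2]mulr2n addrK ltxx.
have := yP _ (nrm (- y) _); rewrite oppr_eq0 normrN scalerN => /(_ y0).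
have -> : - (`|y|^-1 *: y) + y = (1 - `|y|^-1) *: y.
  by rewrite scalerBl scale1r addrC.
rewrite normrZ -{2}(normr_id y) -normrM mulrBl mul1r mulVf ?normr_eq0//.
rewrite ltNge => /negP; apply; rewrite ler_norml.
have {}y1 : `|y| <= 1 := y1; have := normr_ge0 y.
by move=> y0'; apply/andP; split; lra.
Qed.

End daugavet.

(* B is a Cech-Stone compactification of T, with e its embedding of T as a
   dense subspace; B and e are unique up to a homeomorphism. *)
Definition cech_stone_compactification (T B : topologicalType) (e : T -> B) :=
  [/\ compact [set: B], hausdorff_space B,
      injective e /\
        (forall U : set T, open U <-> exists2 V, open V & U = e @^-1` V),
      dense (range e) &
      forall Z : topologicalType, compact [set: Z] -> hausdorff_space Z ->
      forall f : T -> Z, continuous f ->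
      exists2 g : B -> Z, continuous g & g \o e = f].

Section supnorm.
Context (R : realType) (I : Type) (X : I -> normedModType R).
Implicit Types f g : forall i, X i.

Definition bounded_family f := exists M, forall i, `|f i| <= M.

Definition supnorm f : R := sup (range (fun i => `|f i|)).

Lemma supnorm_le f M : 0 <= M -> (forall i, `|f i| <= M) -> supnorm f <= M.
Proof.
rewrite /supnorm => M0 fM; have [->|/set0P ne] := eqVneq (range (fun i => `|f i|)) set0.
  by rewrite sup0.
by apply: ge_sup => // _ [i _ <-].
Qed.

Lemma le_supnorm f i : bounded_family f -> `|f i| <= supnorm f.
Proof.
move=> [M fM]; apply: ub_le_sup; last by exists i.
by exists M => _ [j _ <-].
Qed.

Lemma supnorm_ge0 f : bounded_family f -> 0 <= supnorm f.
Proof.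
move=> bf; have [[i]|ni] := pselect (inhabited I).
  exact: le_trans (normr_ge0 (f i)) (le_supnorm _ bf).
rewrite /supnorm; suff -> : range (fun i => `|f i|) = set0 by rewrite sup0.
by rewrite -subset0 => r [i _ _]; exact/ni/inhabits.
Qed.

Lemma bounded_family0 : bounded_family (fun=> 0).
Proof. by exists 0 => i; rewrite normr0. Qed.

Lemma bounded_familyD f g :
  bounded_family f -> bounded_family g -> bounded_family (fun i => f i + g i).
Proof.
move=> [M fM] [N gN]; exists (M + N) => i.
exact: le_trans (ler_normD _ _) (lerD (fM i) (gN i)).
Qed.

Lemma bounded_familyN f : bounded_family f -> bounded_family (fun i => - f i).
Proof. by move=> [M fM]; exists M => i; rewrite normrN. Qed.

Lemma bounded_familyZ (a : R) f :
  bounded_family f -> bounded_family (fun i => a *: f i).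
Proof. by move=> [M fM]; exists (`|a| * M) => i; rewrite normrZ ler_wpM2l ?fM. Qed.

Lemma supnormD f g : bounded_family f -> bounded_family g ->
  supnorm (fun i => f i + g i) <= supnorm f + supnorm g.
Proof.
move=> bf bg; apply: supnorm_le => [|i]; first by rewrite addr_ge0 ?supnorm_ge0.
by apply: le_trans (ler_normD _ _) (lerD _ _); exact: le_supnorm.
Qed.

Lemma supnormZ (a : R) f : bounded_family f ->
  supnorm (fun i => a *: f i) = `|a| * supnorm f.
Proof.
move=> bf; apply/eqP; rewrite eq_le; apply/andP; split.
  apply: supnorm_le => [|i]; first by rewrite mulr_ge0 ?supnorm_ge0.
  by rewrite normrZ ler_wpM2l ?le_supnorm.
have [->|a0] := eqVneq a 0.
  by rewrite normr0 mul0r supnorm_ge0//; exact: bounded_familyZ.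
rewrite mulrC -ler_pdivlMr ?normr_gt0//; apply: supnorm_le => [|i].
  by rewrite divr_ge0 ?supnorm_ge0//; exact: bounded_familyZ.
rewrite ler_pdivlMr ?normr_gt0// mulrC -normrZ.
by apply: (@le_supnorm (fun i => a *: f i)); exact: bounded_familyZ.
Qed.

Lemma supnorm_eq0 f : bounded_family f -> supnorm f = 0 -> forall i, f i = 0.
Proof.
move=> bf f0 i; apply/eqP; rewrite -normr_le0 -f0; exact: le_supnorm.
Qed.

End supnorm.

Section contfun.
Context (R : realType) (K : topologicalType).

(* The proof of compactness is a parameter of the type because the supremum
   norm is defined from it. *)
Record contfun (cK : compact [set: K]) := ContFun {
  contfun_fun :> K -> R ;
  contfun_continuous : continuous contfun_fun }.

Context (cK : compact [set: K]).
Local Notation C := (contfun cK).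
Implicit Types f g h : C.

Lemma contfunP f g : (f : K -> R) = g -> f = g.
Proof.
case: f g => [f cf] [g cg] /= fg; case: g / fg cg => cg.
by congr ContFun; exact: Prop_irrelevance.
Qed.

HB.instance Definition _ := gen_eqMixin C.
HB.instance Definition _ := gen_choiceMixin C.

Lemma contfun_bounded f : @bounded_family R K (fun=> R^o) f.
Proof.
have cA : compact (range (f : K -> R^o)).
  apply: continuous_compact => //; apply: continuous_subspaceT.
  exact: contfun_continuous.
have [M [_ /(_ (M + 1))]] := compact_bounded cA.
rewrite ltrDl => /(_ ltr01) fM.
by exists (M + 1) => x; apply: fM; exists x.
Qed.

Definition contfun0 : C := ContFun cK (@cst_continuous K R 0).
Definition contfunN f : C :=
  ContFun cK (fun x => continuousN (@contfun_continuous _ f x)).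
Definition contfunD f g : C :=
  ContFun cK (fun x =>
    continuousD (@contfun_continuous _ f x) (@contfun_continuous _ g x)).
Lemma contfunZ_subproof (a : R) f : continuous (fun x => a * f x).
Proof. by move=> x; apply: continuousM; [exact: cst_continuous | exact: contfun_continuous]. Qed.
Definition contfunZ (a : R) f : C := ContFun cK (@contfunZ_subproof a f).

Let addA : associative contfunD.
Proof. by move=> f g h; apply: contfunP; apply/funext => x /=; exact: addrA. Qed.
Let addC : commutative contfunD.
Proof. by move=> f g; apply: contfunP; apply/funext => x /=; exact: addrC. Qed.
Let add0 : left_id contfun0 contfunD.
Proof. by move=> f; apply: contfunP; apply/funext => x /=; exact: add0r. Qed.
Let addN : left_inverse contfun0 contfunN contfunD.
Proof. by move=> f; apply: contfunP; apply/funext => x /=; exact: addNr. Qed.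

HB.instance Definition _ := GRing.isZmodule.Build C addA addC add0 addN.

Let scaleA a b f : contfunZ a (contfunZ b f) = contfunZ (a * b) f.
Proof. by apply: contfunP; apply/funext => x /=; exact: mulrA. Qed.
Let scale1 : left_id 1 contfunZ.
Proof. by move=> f; apply: contfunP; apply/funext => x /=; exact: mul1r. Qed.
Let scaleDr : right_distributive contfunZ +%R.
Proof. by move=> a f g; apply: contfunP; apply/funext => x /=; exact: mulrDr. Qed.
Let scaleDl f : {morph contfunZ^~ f : a b / a + b}.
Proof. by move=> a b; apply: contfunP; apply/funext => x /=; exact: mulrDl. Qed.

HB.instance Definition _ :=
  GRing.Zmodule_isLmodule.Build R C scaleA scale1 scaleDr scaleDl.

Definition contfun_norm f : R := @supnorm R K (fun=> R^o) f.

Let normD f g : contfun_norm (f + g) <= contfun_norm f + contfun_norm g.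
Proof. by apply: supnormD; exact: contfun_bounded. Qed.
Let normZ a f : contfun_norm (a *: f) = `|a| * contfun_norm f.
Proof. exact: (supnormZ a (contfun_bounded f)). Qed.
Let norm0_eq0 f : contfun_norm f = 0 -> f = 0.
Proof.
move=> f0; apply: contfunP; apply/funext => x.
exact: (supnorm_eq0 (contfun_bounded f) f0 x).
Qed.

HB.instance Definition _ := Lmodule_isNormed.Build R C normD normZ norm0_eq0.

End contfun.

Section linf_sum.
Context (R : realType) (I : Type) (X : I -> normedModType R).

Record linf_sum := LinfSum {
  linf_fun :> forall i, X i ;
  linf_bounded : bounded_family linf_fun }.

Implicit Types f g h : linf_sum.

Lemma linf_sumP f g : (forall i, f i = g i) -> f = g.
Proof.
case: f g => [f bf] [g bg] /= fg.
have {}fg : f = g by exact: functional_extensionality_dep.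
by case: g / fg bg => bg; congr LinfSum; exact: Prop_irrelevance.
Qed.

HB.instance Definition _ := gen_eqMixin linf_sum.
HB.instance Definition _ := gen_choiceMixin linf_sum.

Definition linf0 := LinfSum (bounded_family0 X).
Definition linfN f := LinfSum (bounded_familyN (linf_bounded f)).
Definition linfD f g :=
  LinfSum (bounded_familyD (linf_bounded f) (linf_bounded g)).
Definition linfZ (a : R) f := LinfSum (bounded_familyZ a (linf_bounded f)).

Let addA : associative linfD.
Proof. by move=> f g h; apply: linf_sumP => i /=; exact: addrA. Qed.
Let addC : commutative linfD.
Proof. by move=> f g; apply: linf_sumP => i /=; exact: addrC. Qed.
Let add0 : left_id linf0 linfD.
Proof. by move=> f; apply: linf_sumP => i /=; exact: add0r. Qed.
Let addN : left_inverse linf0 linfN linfD.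
Proof. by move=> f; apply: linf_sumP => i /=; exact: addNr. Qed.

HB.instance Definition _ := GRing.isZmodule.Build linf_sum addA addC add0 addN.

Let scaleA a b f : linfZ a (linfZ b f) = linfZ (a * b) f.
Proof. by apply: linf_sumP => i /=; exact: scalerA. Qed.
Let scale1 : left_id 1 linfZ.
Proof. by move=> f; apply: linf_sumP => i /=; exact: scale1r. Qed.
Let scaleDr : right_distributive linfZ +%R.
Proof. by move=> a f g; apply: linf_sumP => i /=; exact: scalerDr. Qed.
Let scaleDl f : {morph linfZ^~ f : a b / a + b}.
Proof. by move=> a b; apply: linf_sumP => i /=; exact: scalerDl. Qed.

HB.instance Definition _ :=
  GRing.Zmodule_isLmodule.Build R linf_sum scaleA scale1 scaleDr scaleDl.

Definition linf_norm f : R := supnorm f.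

Let normD f g : linf_norm (f + g) <= linf_norm f + linf_norm g.
Proof. by apply: supnormD; exact: linf_bounded. Qed.
Let normZ a f : linf_norm (a *: f) = `|a| * linf_norm f.
Proof. exact: (supnormZ a (linf_bounded f)). Qed.
Let norm0_eq0 f : linf_norm f = 0 -> f = 0.
Proof.
by move=> f0; apply: linf_sumP; exact: (supnorm_eq0 (linf_bounded f) f0).
Qed.

HB.instance Definition _ :=
  Lmodule_isNormed.Build R linf_sum normD normZ norm0_eq0.

End linf_sum.

(* Main.v *)
From HB Require Import structures.
Require Import Defs.
From mathcomp Require Import all_boot all_order all_algebra lra.
From mathcomp Require Import all_classical all_reals all_analysis.
Import Order.TTheory GRing.Theory Num.Theory.
Import numFieldNormedType.Exports.
Set Implicit Arguments.
Unset Strict Implicit.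
Unset Printing Implicit Defensive.
Local Open Scope classical_set_scope.
Local Open Scope ring_scope.
Local Open Scope card_scope.

(* For K compact, C(K) has the k-Daugavet property if and only if K has no
   reaping family of cardinality at most k.  If there is such a family F, then
   either K has an isolated point p and the indicator function of p is a
   counterexample, or F is infinite and the bump functions +y_W, -y_W supported
   in the members W of F form one: a function x of norm at most 1 that is almost
   at distance 2 from all of them makes {x >= 1/2} and {x <= -1/2} meet every W.
   Conversely, if there is no such family, iterated splitting yields a
   continuous h : K -> R that takes the values 0, ..., 2n - 1 on each of k given
   nonempty open sets.  A point x of a slice can then be corrected near
   {h = 2j} and {h = 2j + 1}, for each j < n, so as to be almost at distance 2
   from k given unit vectors; the n corrections have disjoint supports, so that
   for n large the functional defining the slice is almost unaffected by one
   of them.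

   The summands K_i are clopen in their Cech-Stone compactification B, so that
   reaping families of K_i are reaping families of B.  If F has fewer elements
   than a reaping family of any K_i, functions K_i -> [0, 1] taking both values
   0 and 1 on the trace of every member of F extend to a function on B that
   shows that F is not reaping.  Finally, the l_infty-sum of the spaces C(K_i)
   is isometric to C(B). *)

(** * Cardinals *)

Lemma injective_card_le (T U : Type) (f : T -> U) :
  injective f -> [set: T] #<= [set: U].
Proof.
move=> f_inj.
have [g] : $|{injfun [set: T] >-> [set: U]}|.
  by apply/injfunPex; exists f => // x y _ _; exact: f_inj.
exact: inj_card_le g.
Qed.

Lemma card_le_range (T U : Type) (A : set U) (f : T -> U) :
  A `<=` range f -> A #<= [set: T].
Proof.
by move=> Af; apply: card_le_trans (card_image_le f _); exact: subset_card_le.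
Qed.

Lemma card_le_eq_range (T U : Type) (A : set U) :
  A !=set0 -> A #<= [set: T] -> exists f : T -> U, A = range f.
Proof.
move=> /set0P/eqP A0 /pfcard_geP[//|/surjfunPex[f ->]].
by exists f.
Qed.

(* By Zorn's lemma there is a maximal set D equipped with an injection
   D * bool -> D.  Its complement is countable, so that T injects into D:
   if F0 and F1 are the two halves of the injection and d is in D, the points
   F1 (F0^n (F1 d)) are distinct and not in the range of F0. *)
Lemma card_le_prod_bool (T : Type) :
  infinite_set [set: T] -> [set: T * bool] #<= [set: T].
Proof.
move=> Tinf.
(* [S] is the graph of an injection [D * bool -> D]: it is single-valued, injective, defined at both
   booleans or at neither, and its values lie in [D]. *)
pose good (S : set (T * bool * T)) := [/\
  forall x b y y', S (x, b, y) -> S (x, b, y') -> y = y',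
  forall x b x' b' y, S (x, b, y) -> S (x', b', y) -> (x, b) = (x', b'),
  forall x b y, S (x, b, y) -> exists y', S (x, ~~ b, y') &
  forall x b y, S (x, b, y) -> exists z, S (y, true, z)].
have [S [[Sf Si Sb Sc] Smax]] : exists S, good S /\ forall S', S `<` S' -> ~ good S'.
  apply: Zorn_bigcup => F Fgood Ftot.
  have F2 p q : (\bigcup_(X in F) X) p -> (\bigcup_(X in F) X) q ->
      exists2 X, F X & X p /\ X q.
    move=> [X FX Xp] [Y FY Yq].
    have [XY|YX] := Ftot _ _ FX FY; [exists Y|exists X] => //; split=> //.
    - exact: XY.
    - exact: YX.
  split.
  - move=> x b y y' Sy Sy'; have [X /Fgood[Xf _ _ _] [Xy Xy']] := F2 _ _ Sy Sy'.
    exact: Xf Xy Xy'.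
  - move=> x b x' b' y Sx Sx'; have [X /Fgood[_ Xi _ _] [Xx Xx']] := F2 _ _ Sx Sx'.
    exact: Xi Xx Xx'.
  - move=> x b y [X FX Xx]; have [_ _ Xb _] := Fgood _ FX.
    by have [z Xz] := Xb _ _ _ Xx; exists z; exists X.
  - move=> x b y [X FX Xx]; have [_ _ _ Xc] := Fgood _ FX.
    by have [z Xz] := Xc _ _ _ Xx; exists z; exists X.
pose D := [set x | exists y, S (x, true, y)].
have SD x b y : S (x, b, y) -> D x.
  case: b => [Sx|/Sb[y' Sx]]; first by exists y.
  by exists y'.
have SDr x b y : S (x, b, y) -> D y by move=> /Sc[z Sz]; exists z.
have Dfin : finite_set (~` D).
  apply: contrapT => /infiniteP/card_leP[u0].
  pose u (n : nat) := val (u0 (to_setT n)).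
  have uD n : ~ D (u n) by have /set_mem := valP (u0 (to_setT n)).
  have ui n m : u n = u m -> n = m.
    move=> /val_inj unm; apply: (congr1 val (x := to_setT n) (y := to_setT m)).
    by apply: ('inj_u0) unm; exact: in_setT.
  (* An infinite complement of [D] contains a sequence [u]; doubling indices injects the range of
     [u] times [bool] into that range, which enlarges [S]. *)
  pose v (n : nat) (b : bool) := u (n.*2 + b)%N.
  have vi n b m b' : v n b = v m b' -> (n, b) = (m, b').
    move=> /ui E; have Eb : b = b'.
      by move/(congr1 odd): E; rewrite !oddD !odd_double !oddb.
    by move: E; rewrite Eb => /addIn/(congr1 half); rewrite !doubleK => ->.
  pose S' := S `|` [set p | exists n, p.1.1 = u n /\ p.2 = v n p.1.2].
  apply: (Smax S').
    split=> [|S'S]; first exact: subsetUl.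
    apply: (uD 0%N); apply: (SD _ true (v 0%N true)); apply: S'S.
    by right; exists 0%N.
  split.
  - move=> x b y y' [Sy|[n /= [-> ->]]] [Sy'|[m /= [E ->]]].
    + exact: Sf Sy Sy'.
    + by case: (uD m); rewrite -E; exact: SD Sy.
    + by case: (uD n); exact: SD Sy'.
    + by rewrite (ui _ _ E).
  - move=> x b x' b' y [Sy|[n /= [-> E]]] [Sy'|[m /= [-> E']]].
    + exact: Si Sy Sy'.
    + by case: (uD (m.*2 + b')%N); rewrite -/(v m b') -E'; exact: SDr Sy.
    + by case: (uD (n.*2 + b)%N); rewrite -/(v n b) -E; exact: SDr Sy'.
    + by move: E'; rewrite E => /vi[-> ->].
  - move=> x b y [/Sb[z Sz]|[n /= [-> _]]]; first by exists z; left.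
    by exists (v n (~~ b)); right; exists n.
  - move=> x b y [/Sc[z Sz]|[n /= [_ ->]]]; first by exists z; left.
    by exists (v (n.*2 + b)%N true); right; exists (n.*2 + b)%N.
have [d Dd] : D !=set0.
  apply/set0P/eqP => D0; apply: Tinf.
  by rewrite -setC0 -D0.
have /choice[F FS] (p : T * bool) : exists y, D p.1 -> S (p.1, p.2, y).
  have [[y Sy]|nD] := pselect (D p.1); last by exists p.1.
  case: p.2; first by exists y.
  by have [z Sz] := Sb _ _ _ Sy; exists z.
have FD x b : D x -> D (F (x, b)) by move=> /(FS (x, b)); exact: SDr.
have Finj x b x' b' : D x -> D x' -> F (x, b) = F (x', b') -> (x, b) = (x', b').
  move=> /(FS (x, b))/= Sx /(FS (x', b'))/= Sx' E.
  by apply: (Si _ _ _ _ _ Sx); rewrite E.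
pose w n := iter n (fun x => F (x, false)) (F (d, true)).
have wD n : D (w n) by elim: n => [|n IH]; exact: FD.
have w_inj : injective w.
  elim=> [|n IH] [|m] //= E.
  - by have [] := Finj _ _ _ _ Dd (wD m) E.
  - by have [] := Finj _ _ _ _ (wD n) Dd E.
  - by have [/IH ->] := Finj _ _ _ _ (wD n) (wD m) E.
have /finite_set_countable/countable_injP[c c_inj] := Dfin.
pose h x := if `[< D x >] then F (x, false) else F (w (c x), true).
have hD x : D (h x) by rewrite /h; case: asboolP => [Dx|_]; exact: FD.
have h_inj : injective h.
  move=> x y; rewrite /h; case: (asboolP (D x)) => Dx; case: (asboolP (D y)) => Dy E.
  - by have [] := Finj _ _ _ _ Dx Dy E.
  - by have [] := Finj _ _ _ _ Dx (wD _) E.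
  - by have [] := Finj _ _ _ _ (wD _) Dy E.
  - have [/w_inj] := Finj _ _ _ _ (wD _) (wD _) E.
    by apply: c_inj; rewrite inE.
apply: (@injective_card_le _ _ (fun p => F (h p.1, p.2))) => -[x b] [y b'] /= E.
by have [/h_inj -> ->] := Finj _ _ _ _ (hD x) (hD y) E.
Qed.

(** A minimum of minima is the minimum of the union: [exists_least_card] provides the minimum of
    each inhabited [P j], and an empty [P j] contributes to neither side. *)
Lemma min_card_least_card (I : Type) (P : I -> Type -> Prop) :
  (forall i k k', [set: k] #= [set: k'] -> P i k -> P i k') ->
  min_card (fun i => least_card (P i)) = least_card (fun k => exists i, P i k).
Proof.
move=> Pinv; apply/funext => k; apply/propext; split=> -[[i]].
  move=> [Pik _] kmin; split; first by exists i.
  move=> k' [j Pjk'].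
  have [k'' lk''] : exists k'', least_card (P j) k''.
    by apply: exists_least_card; [exact: Pinv|exists k'].
  by apply: card_le_trans (kmin k'' _) (proj2 lk'' _ Pjk'); exists j.
move=> Pik kmin; split.
  by exists i; split=> // k' Pik'; apply: kmin; exists i.
by move=> k' [j [Pjk' _]]; apply: kmin; exists j.
Qed.

Lemma eq_least_card (P P' : Type -> Prop) :
  (forall k, P k <-> P' k) -> least_card P = least_card P'.
Proof. by move=> PP'; congr least_card; apply/funext => k; exact/propext. Qed.

(** Serves to replace families of cardinality exactly [k] by families of cardinality at most [k]. *)
Lemma least_card_le (P P' : Type -> Prop) :
  (forall k, P k -> P' k) ->
  (forall k, P' k -> exists2 k', P k' & [set: k'] #<= [set: k]) ->
  (forall k k', [set: k] #= [set: k'] -> P k -> P k') ->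
  least_card P = least_card P'.
Proof.
move=> PP' P'P Pinv; apply/funext => k; apply/propext; split=> -[Pk kmin].
  split=> [|k' /P'P[k'' Pk'']]; first exact: PP'.
  by apply: card_le_trans; exact: kmin.
split=> [|k' /PP']; last exact: kmin.
have [k' Pk' k'k] := P'P _ Pk; apply: (Pinv _ _ _ Pk').
by rewrite card_eq_le k'k kmin//; exact: PP'.
Qed.

(** * Reaping families and separating functions *)

(** The bound is an inequality, to match the size condition in [daugavet_property]. *)
Definition reapable (K : topologicalType) (k : Type) :=
  exists2 F : set (set K), reaping_family F & F #<= [set: k].

Lemma reapable_card_eq (K : topologicalType) (k k' : Type) :
  [set: k] #= [set: k'] -> reapable K k -> reapable K k'.
Proof. by move=> kk' [F rF Fk]; exists F => //; rewrite -(card_le_eqr kk'). Qed.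

Lemma reaping_numberE (K : topologicalType) :
  reaping_number K = least_card (reapable K).
Proof.
apply: least_card_le => [k [F rF Fk]|k [F rF Fk]|k k' kk' [F rF Fk]].
- by exists F => //; move: Fk; rewrite card_eq_le => /andP[].
- exists (set_type F); last by rewrite (card_le_eql (card_setT F)).
  by exists F => //; exact/card_esym/card_setT.
- by exists F => //; rewrite -(card_eqr kk').
Qed.

(** The pair of empty closed sets already forces a member into the family. *)
Lemma reapable_inhabited (K : topologicalType) (k : Type) :
  reapable K k -> inhabited k.
Proof.
move=> [F [_ rF] Fk]; have [W FW _] := rF _ _ closed0 closed0 (setI0 _).
have /card_le_eq_range[//|g FE] := Fk; first by exists W.
by move: FW; rewrite FE => -[t].
Qed.

Section urysohn.
Context (R : realType) (K : topologicalType).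
Hypothesis normalK : normal_space K.

(** As [F] is not reaping, some two disjoint closed sets both meet every member of [F]; [g] is a
    Urysohn function for them. *)
Lemma unreapable_separate (k : Type) (F : set (set K)) :
  ~ reapable K k -> F #<= [set: k] ->
  (forall W, F W -> open W /\ W !=set0) ->
  exists g : K -> R, [/\ continuous g, forall p, 0 <= g p <= 1 &
    forall W, F W -> (exists2 p, W p & g p = 0) /\ (exists2 p, W p & g p = 1)].
Proof.
move=> nr Fk FO.
have [L1 [L2 [cL1 cL2 L12 FL]]] : exists L1 L2 : set K,
    [/\ closed L1, closed L2, L1 `&` L2 = set0 &
      forall W, F W -> W `&` L1 !=set0 /\ W `&` L2 !=set0].
  apply: contrapT => nL; apply: nr; exists F => //; split=> // L1 L2 cL1 cL2 L12.
  apply: contrapT => nW; apply: nL; exists L1, L2; split=> // W FW.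
  by split; apply/set0P/eqP => W0; apply: nW; exists W => //; [left|right].
have [g [cg g0 g1 g01]] := urysohn_ext_itv normalK cL1 cL2 L12 (@ltr01 R).
exists g; split=> // [p|W /FL[[p [Wp Lp]] [q [Wq Lq]]]].
  by have /= := g01 (g p); rewrite in_itv/=; apply; exists p.
split; [exists p => //; apply: g0; exists p => //|].
by exists q => //; apply: g1; exists q.
Qed.

Lemma unreapable_levels (k : Type) (n : nat) (W : k -> set K) :
  ~ reapable K k -> (forall t, open (W t) /\ W t !=set0) ->
  exists2 h : K -> R, continuous h &
    forall t i, (i < n)%N -> exists2 p, W t p & h p = i%:R.
Proof.
move=> nr; elim: n W => [|n IHn] W Wo.
  by exists (fun=> 0) => // x; exact: cst_continuous.
have [||g [cg _ gW]] := unreapable_separate (F := range W) nr.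
- exact: card_image_le.
- by move=> _ [t _ <-].
have [t|h ch hW] := IHn (fun t => W t `&` [set p | 1 / 2 < g p]).
  split; last first.
    have [_ [p Wp gp]] := gW (W t) (imageT _ _).
    by exists p; split=> //=; rewrite gp; lra.
  apply: openI; first exact: (Wo t).1.
  apply: (@open_comp _ _ g [set x | 1 / 2 < x]) => [p _|]; first exact: cg.
  exact: open_gt.
(* This function is 0 where [g] vanishes and [h + 1] where [g > 1/2], so level 0 is added below the
   shifted levels of [h]. *)
exists (fun p => (h p + 1) * Num.min 1 (2 * g p)).
  move=> p; apply: (@continuousM R K (fun p => h p + 1) (fun p => Num.min 1 (2 * g p))).
    by apply: (@continuousD R R^o) => //; [exact: ch|exact: cst_continuous].
  apply: (@continuous_min R K (fun=> 1) (fun p => 2 * g p)).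
    exact: cst_continuous.
  by apply: (@continuousM R K (fun=> 2) g); [exact: cst_continuous|exact: cg].
move=> t [_|i]; last rewrite ltnS => /(hW t)[p [Wp /= gp] hp].
  have [[p Wp gp] _] := gW (W t) (imageT _ _); exists p => //.
  by rewrite gp mulr0 min_r ?mulr0.
exists p => //; rewrite hp min_l; first by rewrite mulr1 -natr1.
by lra.
Qed.

Lemma exists_bump (W : set K) (p : K) : accessible_space K -> open W -> W p ->
  exists g : K -> R, [/\ continuous g, forall q, 0 <= g q <= 1, g p = 1 &
    forall q, ~ W q -> g q = 0].
Proof.
move=> aK oW Wp; have cp := accessible_closed_set1 aK (x := p).
have [|g [cg g0 g1 g01]] := urysohn_ext_itv normalK (open_closedC oW) cp _ (@ltr01 R).
  by apply/seteqP; split=> // q [nWq /= qp]; apply: nWq; rewrite qp.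
exists g; split=> // [q||q Wq].
- by have /= := g01 (g q); rewrite in_itv/=; apply; exists q.
- by apply: g1; exists p.
- by apply: g0; exists q.
Qed.

End urysohn.

(** * Tent functions centred at the integers *)

Section tent.
Context (R : realType).
Implicit Types (t : R) (i : nat).

(** The slope 2 gives the support radius 1/2, so that at most one tent is nonzero at any point. *)
Definition tent i t : R := Num.max 0 (1 - 2 * `|t - i%:R|).

Lemma tent_ge0 i t : 0 <= tent i t.
Proof. by rewrite /tent le_max lexx. Qed.

Lemma tentn i : tent i i%:R = 1.
Proof. by rewrite /tent subrr normr0 mulr0 subr0 max_r. Qed.

Lemma continuous_tent i : continuous (tent i).
Proof.
move=> t; apply: (@continuous_max R R (fun=> 0) (fun t => 1 - 2 * `|t - i%:R|)).
  exact: cst_continuous.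
apply: (@continuousB R R^o R (fun=> 1) (fun t => 2 * `|t - i%:R|)).
  exact: cst_continuous.
apply: (@continuousM R R (fun=> 2) (fun t => `|t - i%:R|)).
  exact: cst_continuous.
apply: (@continuous_comp R R R (fun t => t - i%:R) Num.norm).
  apply: (@continuousB R R^o R id (fun=> i%:R)) => //.
  exact: cst_continuous.
exact: (@norm_continuous R R^o).
Qed.

Lemma tent_disjoint i j t : tent i t != 0 -> tent j t != 0 -> i = j.
Proof.
have near m : tent m t != 0 -> `|t - m%:R| < 1 / 2.
  by rewrite ltNge; apply: contraNN => ?; rewrite /tent max_l//; lra.
move=> /near it /near jt; apply/eqP; rewrite eqn_leq.
suff le m n : `|t - m%:R| < 1 / 2 -> `|t - n%:R| < 1 / 2 -> (m <= n)%N by rewrite !le.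
rewrite !ltr_norml => /andP[m1 m2] /andP[n1 n2].
by rewrite -ltnS -(ltr_nat R) -natr1; lra.
Qed.

Lemma tent_neq i j : i != j -> tent i (j%:R : R) = 0.
Proof.
apply: contraNeq => ti; apply/eqP; apply: tent_disjoint ti _.
by rewrite tentn oner_neq0.
Qed.

Lemma sum_tent_le1 n t : \sum_(i < n) tent i t <= 1.
Proof.
have [/existsP[i ti]|/existsPn n0] := boolP [exists i : 'I_n, tent i t != 0].
  rewrite (bigD1 i)//= big1 => [|j ji].
    by rewrite addr0 /tent ge_max ler01/= gerBl mulr_ge0.
  by apply: contraNeq ji => tj; apply/eqP/val_inj; exact: tent_disjoint tj ti.
by rewrite big1 => // i _; apply/eqP; move: (n0 i); rewrite negbK.
Qed.

(** The indices [2j] and [2j+1] for [j < n] run once through the integers below [2n]. *)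
Lemma sum_tent_pair_le1 n t : \sum_(j < n) (tent j.*2 t + tent j.*2.+1 t) <= 1.
Proof.
suff -> : \sum_(j < n) (tent j.*2 t + tent j.*2.+1 t) = \sum_(i < n.*2) tent i t.
  exact: sum_tent_le1.
by elim: n => [|n IHn]; rewrite ?big_ord0// doubleS !big_ord_recr/= IHn addrA.
Qed.

End tent.

(** * The Daugavet property of C(K) *)

Section bounded_functionals.
Context (R : realType) (X : normedModType R) (f : {linear X -> R^o}).
Hypothesis cf : continuous f.

Lemma continuous_functional_bounded : exists2 M, 0 < M & forall x, `|f x| <= M * `|x|.
Proof.
have /linear_boundedP/pinfty_ex_gt0[M M0 fM] : bounded_near f (nbhs (0 : X)).
  exact/linear_bounded_continuous.
by exists M.
Qed.

Lemma has_sup_functional : has_sup (f @` @unit_ball R X).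
Proof.
have [M M0 fM] := continuous_functional_bounded.
split; first by exists (f 0), 0 => //; rewrite /unit_ball/= normr0.
exists M => _ [x x1 <-]; apply: le_trans (ler_norm _) (le_trans (fM x) _).
by rewrite ler_piMr// ltW.
Qed.

End bounded_functionals.

Section contfun_daugavet.
Context (R : realType) (K : topologicalType) (cK : compact [set: K]).
Local Notation C := (contfun R cK).
Implicit Types x y : C.

Lemma contfun_norm_le x M : 0 <= M -> (forall p, `|x p| <= M) -> `|x| <= M.
Proof. exact: supnorm_le. Qed.

Lemma le_contfun_norm x p : `|x p| <= `|x|.
Proof. exact: (le_supnorm _ (contfun_bounded x)). Qed.

Lemma lt_contfun_norm x M : 0 <= M -> M < `|x| -> exists p, M < `|x p|.
Proof.
move=> M0; rewrite ltNge => /negP xM; apply: contrapT => nx; apply: xM.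
by apply: contfun_norm_le => // p; rewrite leNgt; apply/negP => ?; apply: nx; exists p.
Qed.

Lemma contfunDE x y p : (x + y) p = x p + y p. Proof. by []. Qed.

Lemma contfunNE x p : (- x) p = - x p. Proof. by []. Qed.

Lemma contfun_sumE n (x : 'I_n -> C) p : (\sum_(i < n) x i) p = \sum_(i < n) x i p.
Proof. by elim/big_rec2: _ => // i a b _ <-. Qed.

(** With this sign, the slice of width 1 consists of functions negative at an isolated point [p],
    where the bump is 1. *)
Definition neg_eval p x : R^o := - x p.

Lemma neg_eval_linear p : linear (neg_eval p).
Proof. by move=> a x y; rewrite /neg_eval /= opprD -mulrN. Qed.

HB.instance Definition _ p :=
  GRing.isLinear.Build R C R^o *:%R (neg_eval p) (neg_eval_linear p).

Lemma continuous_neg_eval p : continuous (neg_eval p).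
Proof.
apply: bounded_linear_continuous; apply/bounded_funP => r; exists r => x.
by apply: le_trans; rewrite /neg_eval normrN; exact: le_contfun_norm.
Qed.

Hypothesis hK : hausdorff_space K.

Let normalK : normal_space K. Proof. exact: compact_normal. Qed.
Let accessibleK : accessible_space K. Proof. exact: hausdorff_accessible. Qed.

Lemma exists_contfun_bump (W : set K) (p : K) : open W -> W p ->
  exists x : C, [/\ `|x| = 1, forall q, 0 <= x q <= 1, x p = 1 &
    forall q, ~ W q -> x q = 0].
Proof.
move=> oW Wp; have [g [cg g01 gp gW]] := exists_bump R normalK accessibleK oW Wp.
exists (ContFun cK cg); split=> //; apply/eqP; rewrite eq_le; apply/andP; split.
  apply: contfun_norm_le => // q; have /andP[g0 g1] := g01 q.
  by rewrite ger0_norm.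
by apply: le_trans (le_contfun_norm _ p); rewrite /= gp normr1.
Qed.

(** If [F] were finite, one could choose a point [u W] in each member [W], then a point [v W] of [W]
    outside the finite set of all [u W]. The two finite sets are closed and disjoint, and both meet
    every member. *)
Lemma infinite_reaping_family (F : set (set K)) :
  (forall p : K, ~ open [set p]) -> reaping_family F -> infinite_set F.
Proof.
move=> noiso [FO rF] finF.
have fin_closed := (@accessible_finite_set_closed K).1 accessibleK.
have WD W (A : set K) : open W -> W !=set0 -> finite_set A -> exists p, W p /\ ~ A p.
  move=> oW [p Wp] finA; apply: contrapT => nWA; apply: (noiso p).
  have WA : W `<=` A.
    by move=> q Wq; apply: contrapT => nAq; apply: nWA; exists q.
  (* A nonempty open set inside a finite set would have isolated points. *)
  suff -> : [set p] = W `&` ~` (A `\ p).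
    apply: openI => //; apply: closed_openC; apply: fin_closed.
    exact: finite_setD.
  apply/seteqP; split=> [q ->|q [/WA Aq nApq]]; first by split=> // -[_]; apply.
  by apply: contrapT => qp; apply: nApq.
have /choice[u uP] (W : set K) : exists p, F W -> W p.
  have [FW|nFW] := pselect (F W); first by have [_ [p Wp]] := FO _ FW; exists p.
  have [W' FW' _] := rF _ _ closed0 closed0 (setI0 _).
  by have [_ [p _]] := FO _ FW'; exists p.
have /choice[v vP] (W : set K) : exists p, F W -> W p /\ ~ (u @` F) p.
  have [FW|nFW] := pselect (F W); last by exists (u W).
  have [oW W0] := FO _ FW.
  by have [p pP] := WD _ _ oW W0 (finite_image u finF); exists p.
have [|W FW] := rF _ _ (fin_closed _ (finite_image u finF))
    (fin_closed _ (finite_image v finF)).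
  apply/seteqP; split=> // q [uq [W FW vW]].
  by apply: (vP _ FW).2; rewrite vW.
have Wu := uP _ FW; have [Wv _] := vP _ FW.
have uF : (u @` F) (u W) by exists W.
have vF : (v @` F) (v W) by exists W.
move=> [W0|W0].
  by have : (W `&` u @` F) (u W) by []; rewrite W0.
by have : (W `&` v @` F) (v W) by []; rewrite W0.
Qed.

(** For [y] the indicator function of [p] and [x] in the unit ball with [x p < 0], the sum [y + x]
    has norm at most 1, both at [p] and elsewhere. *)
Lemma isolated_not_daugavet (k : Type) (p : K) :
  open [set p] -> inhabited k -> ~ daugavet_property C k.
Proof.
move=> op [t] dC; have [y [y1 y01 yp y0]] := exists_contfun_bump op (erefl p).
have Yk : [set y] #<= [set: k].
  by apply: (@card_le_range k _ _ (fun=> y)) => _ ->; exists t.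
have [//|x [x1 xp] /(_ y erefl)] :=
  dC [set y] _ Yk (neg_eval p) (@continuous_neg_eval p) 1 1 ltr01 ltr01.
  by move=> _ ->.
apply/negP; rewrite -leNgt (_ : 2 - 1 = 1); last by lra.
have {}x1 q : `|x q| <= 1 by exact: le_trans (le_contfun_norm x q) x1.
have {}xp : x p < 0.
  rewrite -oppr_gt0; apply: le_lt_trans xp; rewrite subr_ge0.
  apply: ub_le_sup; first exact: (has_sup_functional (@continuous_neg_eval p)).2.
  exists (- y); first by rewrite /unit_ball/= normrN y1.
  exact: etrans (opprK (y p)) yp.
apply: contfun_norm_le => // q; rewrite contfunDE.
have [->|qp] := pselect (q = p); last by rewrite (y0 q qp) add0r.
by rewrite yp; move: (x1 p); rewrite !ler_norml => /andP[? _]; apply/andP; split; lra.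
Qed.

Lemma reapable_not_daugavet (k : Type) : reapable K k -> ~ daugavet_property C k.
Proof.
move=> rK; have k0 := reapable_inhabited rK.
have [[p op]|noiso] := pselect (exists p : K, open [set p]).
  exact: isolated_not_daugavet op k0.
have [F rF Fk] := rK.
have {noiso}Finf : infinite_set F.
  by apply: infinite_reaping_family rF => p op; apply: noiso; exists p.
have kinf : infinite_set [set: k] by move=> /(card_le_finite Fk).
have [g FE] := card_le_eq_range (infinite_setN0 Finf) Fk.
have Fg t : F (g t) by rewrite FE; exists t.
have /choice[z zP] t : exists x : C, [/\ `|x| = 1, forall q, 0 <= x q <= 1 &
    forall q, ~ g t q -> x q = 0].
  have [og [p gp]] := rF.1 _ (Fg t).
  by have [x [? ? _ ?]] := exists_contfun_bump og gp; exists x.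
pose y (p : k * bool) := if p.2 then z p.1 else - z p.1.
have Yk : range y #<= [set: k].
  exact: card_le_trans (card_image_le _ _) (card_le_prod_bool kinf).
have Y1 : range y `<=` @unit_sphere R C.
  move=> _ [[t b] _ <-]; rewrite /y /unit_sphere/=.
  by have [z1 _ _] := zP t; case: b => //; rewrite normrN.
(* The slice of width 1 of the zero functional is the whole ball. *)
have c0 : continuous ((\0 : {linear C -> R^o}) : C -> R^o).
  by move=> x; exact: cst_continuous.
have half_gt0 : 0 < 1 / 2 :> R by lra.
move=> /(_ _ Y1 Yk _ c0 1 (1 / 2) ltr01 half_gt0)[x [x1 _] xy].
have {}x1 q : `|x q| <= 1 by exact: le_trans (le_contfun_norm x q) x1.
have cx : continuous x by exact: contfun_continuous.
have [|||W] := rF.2 [set q | 1 / 2 <= x q] [set q | x q <= - (1 / 2)].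
- by apply: (@preimage_closed _ _ x [set r | 1 / 2 <= r]) => //; exact: closed_ge.
- by apply: (@preimage_closed _ _ x [set r | r <= - (1 / 2)]) => //; exact: closed_le.
- by apply/seteqP; split=> // q [/=]; lra.
rewrite FE => -[t _ <-]; have [z1 z01 z0] := zP t.
have h0 : 0 <= 2 - 1 / 2 :> R by lra.
have gz q : z t q != 0 -> g t q by move=> zq; apply: contrapT => /z0/eqP; exact/negP.
have pos : exists2 q, g t q & 1 / 2 <= x q.
  (* At a point with [|z t q + x q| > 3/2], the bump cannot vanish because [|x q| <= 1]; as
     [0 <= z t q <= 1], the sum is positive and [x q > 1/2]. *)
  have [q] := lt_contfun_norm h0 (xy (y (t, true)) (imageT _ _)).
  rewrite contfunDE =>  xq; exists q.
    apply: gz; apply: contraTneq xq => ->.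
    by rewrite add0r -leNgt; apply: le_trans (x1 q) _; lra.
  by move: (z01 q) (x1 q) xq; rewrite ler_norml ltr_normr; lra.
have neg : exists2 q, g t q & x q <= - (1 / 2).
  have [q] := lt_contfun_norm h0 (xy (y (t, false)) (imageT _ _)).
  rewrite contfunDE contfunNE =>  xq; exists q.
    apply: gz; apply: contraTneq xq => ->.
    by rewrite oppr0 add0r -leNgt; apply: le_trans (x1 q) _; lra.
  by move: (z01 q) (x1 q) xq; rewrite ler_norml ltr_normr; lra.
move=> [g0|g0].
  by have [q gq xq] := pos; have : (g t `&` [set q | 1 / 2 <= x q]) q by []; rewrite g0.
by have [q gq xq] := neg; have : (g t `&` [set q | x q <= - (1 / 2)]) q by []; rewrite g0.
Qed.

End contfun_daugavet.

(** * Compact spaces without small reaping families *)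

Section unreapable_daugavet.
Context (R : realType) (K : topologicalType) (cK : compact [set: K]).
Local Notation C := (contfun R cK).
Hypothesis hK : hausdorff_space K.

(* Moves x to 1 where h = 2j and to -1 where h = 2j + 1; for distinct j the
   corrections have disjoint supports. *)
Definition correction (h : K -> R) (x : C) (j : nat) (p : K) : R :=
  tent j.*2 (h p) * (1 - x p) - tent j.*2.+1 (h p) * (1 + x p).

Lemma continuous_correction h (x : C) j : continuous h -> continuous (correction h x j).
Proof.
move=> ch p; have cx := @contfun_continuous _ _ _ x p.
have ct i : {for p, continuous (fun p => tent i (h p))}.
  by apply: (@continuous_comp _ _ _ h (tent i)); [exact: ch|exact: continuous_tent].
apply: (@continuousB R R^o K (fun p => tent j.*2 (h p) * (1 - x p))).
  apply: (@continuousM R K (fun p => tent j.*2 (h p)) (fun p => 1 - x p)) => //.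
  by apply: (@continuousB R R^o K (fun=> 1)) => //; exact: cst_continuous.
apply: (@continuousM R K (fun p => tent j.*2.+1 (h p)) (fun p => 1 + x p)) => //.
by apply: (@continuousD R R^o K (fun=> 1)) => //; exact: cst_continuous.
Qed.

(** The corrected value is a convex combination of [x p], 1 and -1, the last two weighted by the
    tents. *)
Lemma norm_add_correction h (x : C) j p :
  `|x p| <= 1 -> `|x p + correction h x j p| <= 1.
Proof.
rewrite /correction !ler_norml => /andP[x1 x2].
have u0 := tent_ge0 j.*2 (h p); have v0 := tent_ge0 j.*2.+1 (h p).
have uv1 : tent j.*2 (h p) + tent j.*2.+1 (h p) <= 1.
  apply: le_trans (sum_tent_pair_le1 j.+1 (h p)).
  rewrite big_ord_recr/= lerDr sumr_ge0// => i _.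
  by rewrite addr_ge0 ?tent_ge0.
by apply/andP; split; nra.
Qed.

(** Each correction is at most twice the sum of its two tents. That the bound does not depend on [n]
    is what limits the loss under a functional. *)
Lemma norm_sum_correction h (x : C) n p :
  `|x p| <= 1 -> `|\sum_(j < n) correction h x j p| <= 2.
Proof.
move=> x1; apply: le_trans (ler_norm_sum _ _ _) _.
apply: (@le_trans _ _ (\sum_(j < n) 2 * (tent j.*2 (h p) + tent j.*2.+1 (h p)))).
  apply: ler_sum => j _; rewrite /correction.
  have u0 := tent_ge0 j.*2 (h p); have v0 := tent_ge0 j.*2.+1 (h p).
  by move: x1; rewrite !ler_norml => /andP[? ?]; apply/andP; split; nra.
by rewrite -mulr_sumr ler_piMr// sum_tent_pair_le1.
Qed.

Lemma correction_even h (x : C) j p : h p = j.*2%:R -> x p + correction h x j p = 1.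
Proof.
move=> hp; rewrite /correction hp tentn (@tent_neq _ j.*2.+1); first by lra.
by rewrite eqn_leq ltnn.
Qed.

Lemma correction_odd h (x : C) j p :
  h p = j.*2.+1%:R -> x p + correction h x j p = - 1.
Proof.
move=> hp; rewrite /correction hp tentn (@tent_neq _ j.*2); first by lra.
by rewrite eqn_leq ltnn andbF.
Qed.

Lemma unreapable_daugavet (k : Type) : ~ reapable K k -> daugavet_property C k.
Proof.
move=> nr Y Y1 Yk f cf a e a0 e0.
have [M M0 fM] := continuous_functional_bounded cf.
(* Half of the width is spent on placing [x] near the supremum, the other half on the loss caused by
   a correction. *)
have a2 : 0 < a / 2 by rewrite divr_gt0.
have [_ [x x1 <-] xs] := sup_adherent a2 (has_sup_functional cf).
have {x1}x1 : `|x| <= 1 := x1.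
have [Y0|/set0P YN0] := eqVneq Y set0.
  by exists x; [split=> //; apply: lt_trans xs; lra|rewrite Y0].
have [y YE] := card_le_eq_range YN0 Yk.
have y1 t : `|y t| = 1 by apply: Y1; rewrite YE; exists t.
have /choice[s sP] (t : k) : exists s : R, (s = 1 \/ s = - 1) /\
    [set p | 1 - e < s * y t p] !=set0.
  (* The maximum with 0 covers [e > 1], since [lt_contfun_norm] asks for a nonnegative bound. *)
  have [||p] := @lt_contfun_norm _ _ _ (y t) (Num.max 0 (1 - e)).
  - by rewrite le_max lexx.
  - by rewrite y1 gt_max ltr01/=; lra.
  rewrite gt_max => /andP[_]; rewrite ltr_normr => /orP[yp|yp].
    by exists 1; split; [left|exists p; rewrite /= mul1r].
  by exists (- 1); split; [right|exists p; rewrite /= mulN1r].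
(* If [f] were at most [-a/2] on [n] functions whose sum has norm at most 2, this would contradict
   [|f z| <= M * |z|]. *)
have [n nM] : exists n : nat, 2 * M < a / 2 * n%:R.
  exists (Num.truncn (2 * M / (a / 2))).+1.
  by rewrite [ltRHS]mulrC -ltr_pdivrMr// truncnS_gt.
have [t|h ch hW] := @unreapable_levels R K (compact_normal hK cK) k n.*2
    (fun t => [set p | 1 - e < s t * y t p]) nr.
  have [_ W0] := sP t; split=> //.
  apply: (@open_comp _ _ (fun p => s t * y t p) [set r | 1 - e < r]) => [p _|].
    by apply: (@continuousM R K (fun=> s t) (y t));
      [exact: cst_continuous|exact: contfun_continuous].
  exact: open_gt.
pose d (j : 'I_n) : C := ContFun cK (@continuous_correction h x j ch).
have xp p : `|x p| <= 1 by exact: le_trans (le_contfun_norm x p) x1.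
have sumd : `|\sum_(j < n) d j| <= 2.
  by apply: contfun_norm_le => // p; rewrite contfun_sumE; exact: norm_sum_correction.
(* The d_j have disjoint supports, so that f cannot be small on all of them. *)
have [j fd] : exists j, - (a / 2) < f (d j).
  apply: contrapT => /forallNP nd.
  have : f (\sum_(j < n) d j) <= - (a / 2 * n%:R).
    rewrite linear_sum/= -mulNr mulr_natr -[n in _ *+ n]card_ord -sumr_const.
    by apply: ler_sum => j _; rewrite leNgt; exact/negP/nd.
  have := fM (\sum_(j < n) d j); rewrite ler_norml => /andP[fs _] sf.
  by move: nM; rewrite ltNge => /negP; apply; nra.
exists (x + d j).
  split; last by rewrite linearD/=; lra.
  by apply: contfun_norm_le => // p; exact: norm_add_correction.
rewrite YE => _ [t _ <-].
have [s1 _] := sP t.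
(* Level [2j] serves the sign 1 and level [2j+1] the sign -1; at such a point, [s t] times the value
   of [y t + (x + d j)] exceeds [(1 - e) + 1]. *)
have [p /= yp hp] : exists2 p, 1 - e < s t * y t p & x p + d j p = s t.
  have jn : (j.*2.+1 < n.*2)%N by rewrite -doubleS leq_double.
  case: s1 => sE.
    have [p yp /(correction_even x) hp] := hW t j.*2 (ltnW jn).
    by exists p; rewrite // sE.
  have [p yp /(correction_odd x) hp] := hW t j.*2.+1 jn.
  by exists p; rewrite // sE.
apply: lt_le_trans (le_contfun_norm _ p); rewrite !contfunDE hp ltr_normr.
by case: s1 yp => ->; [rewrite mul1r|rewrite mulN1r] => yp; apply/orP; [left|right]; lra.
Qed.

Lemma daugavet_property_contfun (k : Type) :
  daugavet_property C k <-> ~ reapable K k.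
Proof.
split=> [dC rK|]; last exact: unreapable_daugavet.
exact: reapable_not_daugavet rK dC.
Qed.

End unreapable_daugavet.

(** * Cech-Stone compactifications of discrete unions *)

Section cech_stone_extension.
Context (R : realType) (T B : topologicalType) (e : T -> B).
Hypothesis eB : cech_stone_compactification e.

Lemma cech_stone_continuous : continuous e.
Proof.
by have [_ _ [_ eo] _ _] := eB; apply/continuousP => V oV; apply/eo; exists V.
Qed.

(** The universal property concerns compact Hausdorff targets, so [g] is viewed as a map into the
    subspace [[-M, M]], onto which [clamp] retracts the line. *)
Lemma cech_stone_extension (g : T -> R) (M : R) :
  continuous g -> (forall x, `|g x| <= M) ->
  exists2 G : B -> R, continuous G & forall x, G (e x) = g x.
Proof.
move=> cg gM; have [_ _ _ _ ext] := eB.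
have [M0|M0] := ltP M 0.
  (* A negative bound means that [T] is empty. *)
  exists (fun=> 0) => [b|x]; first exact: cst_continuous.
  by have := le_lt_trans (gM x) M0; rewrite ltNge normr_ge0.
pose A : set R := [set r | - M <= r <= M].
have clampA r : Num.max (- M) (Num.min M r) \in A.
  by rewrite inE /A /= le_max lexx ge_max ge_min lexx andbT/=; lra.
pose clamp r : set_type A := SigSub (clampA r).
have cclamp : continuous clamp.
  apply: (@continuous_comp_initial (set_type A) R R set_val) => r.
  apply: (@continuous_max R R (fun=> - M) (fun r => Num.min M r)).
    exact: cst_continuous.
  by apply: (@continuous_min R R (fun=> M) id) => //; exact: cst_continuous.
have cval : continuous (set_val : set_type A -> R) by exact: initial_continuous.
have clampE r : A r -> set_val (clamp r) = r.
  move=> /andP[r1 r2]; rewrite set_valE/= min_r// max_r//.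
have cA : compact [set: set_type A].
  suff -> : [set: set_type A] = clamp @` `[- M, M]%classic.
    apply: continuous_compact; first exact: continuous_subspaceT.
    exact: segment_compact.
  apply/seteqP; split=> // z _; have /set_mem zA := valP z.
  by exists (val z); [rewrite /= in_itv|apply: val_inj; exact: clampE].
have hA : hausdorff_space (set_type A).
  move=> p q pq; apply: val_inj; apply: Rhausdorff => U V Up Vq.
  have [z [zU zV]] := pq _ _ (cval p _ Up) (cval q _ Vq).
  by exists (set_val z).
have [x|G cG Ge] := ext _ cA hA (clamp \o g).
  by apply: continuous_comp; [exact: cg|exact: cclamp].
exists (set_val \o G) => [b|x].
  by apply: continuous_comp; [exact: cG|exact: cval].
rewrite -[LHS]/(set_val ((G \o e) x)) Ge /= clampE// /A/=.
by rewrite -ler_norml.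
Qed.

End cech_stone_extension.

Section disjoint_union.
Context (R : realType) (I : choiceType) (K : I -> topologicalType).
Hypothesis cK : forall i, compact [set: K i].
Hypothesis hK : forall i, hausdorff_space (K i).
Context (B : topologicalType) (e : {i & K i} -> B).
Hypothesis eB : cech_stone_compactification e.

Let ei i (p : K i) : B := e (existT _ i p).

Let continuous_ei i : continuous (@ei i).
Proof.
move=> p; apply: (@continuous_comp _ _ _ (existT _ i) e).
  exact: existT_continuous.
exact: (cech_stone_continuous eB).
Qed.

(* The extension to B of the indicator function of K i is the indicator
   function of the (compact) image of K i. *)
Lemma open_range_summand i : open (range (@ei i)).
Proof.
have [cB hB _ De _] := eB.
have clE : closed (range (@ei i)).
  apply: compact_closed => //; apply: continuous_compact => //.
  exact/continuous_subspaceT/continuous_ei.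
pose chi (x : {i & K i}) : R := (projT1 x == i)%:R.
have [|x|G cG Ge] := @cech_stone_extension R _ _ _ eB chi 1.
- apply: (@sigT_continuous _ _ R (fun j (_ : K j) => (j == i)%:R)) => j.
  by move=> p; exact: cst_continuous.
- by rewrite /chi; case: eqP; rewrite ?normr1 ?normr0.
have oG : open (G @^-1` [set r | 1 / 2 < r]).
  by apply: open_comp => [b _|]; [exact: cG|exact: open_gt].
suff -> : range (@ei i) = G @^-1` [set r | 1 / 2 < r] by [].
apply/seteqP; split=> [_ [p _ <-]|b Gb] /=.
  by rewrite /ei Ge /chi eqxx/=; lra.
apply: contrapT => nb.
(* Density yields a point of a summand [K j] with [G > 1/2] outside the image of [K i]; but on the
   summands [G] is the indicator function of [K i]. *)
have [||c [[Gx nx] [[j q] _ xE]]] := De (G @^-1` [set r | 1 / 2 < r] `&` ~` range (@ei i)).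
- by exists b.
- by apply: openI => //; exact: closed_openC.
move: Gx nx; rewrite -xE /= Ge /chi /=.
case: eqP q xE => [-> q _ _|_ q _ /=]; first by apply; exists q.
by rewrite mulr0n; lra.
Qed.

(** As [e] is an embedding, the image is the trace of an open set of [B] on the open image of
    [K i]. *)
Lemma open_image_summand i (W : set (K i)) : open W -> open (@ei i @` W).
Proof.
move=> oW; have [_ _ [einj eo] _ _] := eB.
have [V oV VE] := (eo _).1 (@existT_open_map _ _ i W oW).
suff -> : @ei i @` W = V `&` range (@ei i).
  by apply: openI => //; exact: open_range_summand.
apply/seteqP; split=> [_ [p Wp <-]|b [Vb [p _ pb]]].
  split; last by exists p.
  by suff : (e @^-1` V) (existT _ i p) by []; rewrite -VE; exists p.
have : (e @^-1` V) (existT _ i p) by rewrite /= -/(ei p) pb.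
by rewrite -VE => -[q Wq qp]; exists q => //; rewrite -pb /ei qp.
Qed.

Lemma reapable_cech_stone (k : Type) :
  reapable B k <-> exists i, reapable (K i) k.
Proof.
have [cB hB [einj eo] De _] := eB.
split=> [[F [FO rF] Fk]|[i [F [FO rF] Fk]]].
  apply: contrapT => /forallNP nr.
  have /all_sig[g gP] i : {g : K i -> R | [/\ continuous g, forall p, 0 <= g p <= 1 &
      forall W, F W -> @ei i @^-1` W !=set0 ->
      (exists2 p, W (ei p) & g p = 0) /\ (exists2 p, W (ei p) & g p = 1)]}.
    apply: cid.
    (* Members of [F] may miss [K i]; only the nonempty traces are to be split. *)
    pose Fi := [set @ei i @^-1` W | W in F] `&` [set W | W !=set0].
    have [||g [cg g01 gF]] := unreapable_separate R (compact_normal (@hK i) (@cK i))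
        (F := Fi) (nr i).
    - apply: card_le_trans Fk; apply: card_le_trans (card_image_le _ _).
      by apply: subset_card_le; exact: subIsetl.
    - move=> _ [[W FW <-] W0]; split=> //.
      by apply: open_comp (FO _ FW).1 => p _; exact: continuous_ei.
    exists g; split=> // W FW W0; apply: gF; split=> //.
    by exists W.
  have [|[i p]|G cG Ge] := @cech_stone_extension R _ _ _ eB (fun x => g _ (projT2 x)) 1.
  - by apply: (@sigT_continuous _ _ _ g) => i; have [] := gP i.
  - have [_ /(_ p)/andP[g0 g1] _] := gP i.
    by rewrite /= ger0_norm.
  have [|||W FW] := rF (G @^-1` [set r | r <= 0]) (G @^-1` [set r | 1 <= r]).
  - by apply: preimage_closed => //; exact: closed_le.
  - by apply: preimage_closed => //; exact: closed_ge.
  - by apply/seteqP; split=> // b [/=]; lra.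
  (* By density [W] has a nonempty trace on some [K i], where [G] takes both values 0 and 1, so [W]
     meets both closed sets. *)
  have [oW W0] := FO _ FW; have [b [Wx [[i p] _ xE]]] := De _ W0 oW.
  have [_ _ /(_ W FW)] := gP i.
  have We : (@ei i @^-1` W) !=set0 by exists p; rewrite /ei /= xE.
  move=> /(_ We)[[q0 Wq0 g0] [q1 Wq1 g1]].
  move=> [WG|WG].
    suff : (W `&` G @^-1` [set r | r <= 0]) (ei q0) by rewrite WG.
    by split=> //; rewrite /ei /= Ge /= g0.
  suff : (W `&` G @^-1` [set r | 1 <= r]) (ei q1) by rewrite WG.
  by split=> //; rewrite /ei /= Ge /= g1.
(* The images are open, and disjoint closed sets of [B] have disjoint closed traces on [K i]. *)
exists [set @ei i @` W | W in F]; last exact: card_le_trans (card_image_le _ _) Fk.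
split=> [_ [W FW <-]|L1 L2 cL1 cL2 L12].
  have [oW [p Wp]] := FO _ FW.
  by split; [exact: open_image_summand|exists (ei p), p].
have cei L : closed L -> closed (@ei i @^-1` L).
  by move=> cL; apply: preimage_closed => //; exact: continuous_ei.
have [|W FW WL] := rF _ _ (cei _ cL1) (cei _ cL2).
  by rewrite -preimage_setI L12 preimage_set0.
exists (@ei i @` W); first by exists W.
by case: WL => WL; [left|right]; apply/seteqP; split=> // _ [[p Wp <-] Lp];
  have : set0 p by rewrite -WL.
Qed.

End disjoint_union.

(** * Isometries and the sum of the spaces of continuous functions *)

Lemma daugavet_property_isometry (R : realType) (X X' : normedModType R)
    (phi : {linear X -> X'}) (k : Type) :
  (forall x, `|phi x| = `|x|) -> (forall x', exists x, phi x = x') ->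
  daugavet_property X k -> daugavet_property X' k.
Proof.
move=> phiN phiS dX Y Y1 Yk f cf a e a0 e0.
have /choice[psi psiK] := phiS.
have cphi : continuous phi.
  apply: bounded_linear_continuous; apply/bounded_funP => r; exists r => x.
  by rewrite phiN.
have cfphi : continuous ((f \o phi : {linear X -> R^o}) : X -> R^o).
  by move=> x; apply: continuous_comp; [exact: cphi|exact: cf].
have ballE : (f \o phi) @` @unit_ball R X = f @` @unit_ball R X'.
  apply/seteqP; split=> [_ [x x1 <-]|_ [x x1 <-]].
    by exists (phi x) => //; rewrite /unit_ball/= phiN.
  by exists (psi x); rewrite /= ?psiK// /unit_ball/= -phiN psiK.
have [||x [x1 fx] xY] := dX (psi @` Y) _ _ _ cfphi a e a0 e0.
- by move=> _ [y Yy <-]; rewrite /unit_sphere/= -phiN psiK; exact: Y1.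
- exact: card_le_trans (card_image_le _ _) Yk.
exists (phi x); first by split; [rewrite /unit_ball/= phiN|rewrite -ballE].
move=> y Yy; rewrite -{1}(psiK y) -linearD phiN.
by apply: xY; exists y.
Qed.

Lemma linear_isometry_inverse (R : realType) (X X' : normedModType R)
    (phi : {linear X -> X'}) :
  (forall x, `|phi x| = `|x|) -> (forall x', exists x, phi x = x') ->
  exists psi : {linear X' -> X}, (forall x', `|psi x'| = `|x'|) /\ cancel phi psi.
Proof.
move=> phiN phiS; have /choice[psi psiK] := phiS.
have phi_inj x y : phi x = phi y -> x = y.
  move=> xy; apply/eqP; rewrite -subr_eq0 -normr_eq0 -phiN.
  by rewrite linearB xy subrr normr0.
have psi_lin : linear psi by move=> a x y; apply: phi_inj; rewrite linearP !psiK.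
pose psiL : {linear X' -> X} := HB.pack psi (GRing.isLinear.Build R X' X *:%R psi psi_lin).
exists psiL; split=> [x|x]; first by rewrite -phiN psiK.
by apply: phi_inj; rewrite psiK.
Qed.

Section linf_sum_contfun.
Context (R : realType) (I : choiceType) (K : I -> topologicalType).
Context (cK : forall i, compact [set: K i]).
Context (B : topologicalType) (cB : compact [set: B]) (e : {i & K i} -> B).
Hypothesis ce : continuous e.
Local Notation L := (linf_sum (fun i => contfun R (@cK i))).

Lemma continuous_restrict (G : contfun R cB) i :
  continuous (fun p : K i => G (e (existT _ i p))).
Proof.
move=> p; apply: (@continuous_comp _ _ _ (fun p : K i => e (existT _ i p)) G).
  apply: (@continuous_comp _ _ _ (existT _ i) e); last exact: ce.
  exact: existT_continuous.
exact: contfun_continuous.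
Qed.

Definition restrict_summand (G : contfun R cB) i : contfun R (@cK i) :=
  ContFun (@cK i) (@continuous_restrict G i).

Lemma bounded_restrict G : bounded_family (restrict_summand G).
Proof.
by exists `|G| => i; apply: contfun_norm_le => // p; exact: (le_contfun_norm G).
Qed.

Definition restrict_linf (G : contfun R cB) : L := LinfSum (bounded_restrict G).

Lemma restrict_linf_linear : linear restrict_linf.
Proof.
by move=> a G H; apply: linf_sumP => i; apply: contfunP; apply/funext.
Qed.

HB.instance Definition _ := GRing.isLinear.Build R (contfun R cB) L *:%R
  restrict_linf restrict_linf_linear.

(** The open set where [|G|] exceeds the norm of the restrictions contains no point of a summand,
    hence is empty by density. *)
Lemma norm_restrict_linf (De : dense (range e)) G : `|restrict_linf G| = `|G|.
Proof.
apply/eqP; rewrite eq_le; apply/andP; split.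
  apply: supnorm_le => // i; apply: contfun_norm_le => // p.
  exact: (le_contfun_norm G).
apply: contfun_norm_le => // b; rewrite leNgt; apply/negP => Gb.
have [||c [Gc [[i p] _ pc]]] :=
    De ((fun b => `|G b|) @^-1` [set r | `|restrict_linf G| < r]).
- by exists b.
- apply: (@open_comp B R (fun b => `|G b|)) => [c _|]; last exact: open_gt.
  apply: (@continuous_comp B R R G Num.norm); first exact: contfun_continuous.
  exact: (@norm_continuous R R^o).
move: Gc; rewrite -pc /= ltNge => /negP; apply.
apply: le_trans (le_contfun_norm (restrict_linf G i) p) _.
exact: (@le_supnorm _ _ _ _ i (linf_bounded (restrict_linf G))).
Qed.

End linf_sum_contfun.

(** Restriction to the summands is a linear isometry onto the sum: a bounded family of continuous
    functions glues to one bounded continuous function on the disjoint union, which extends to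
    [B]. *)
Lemma daugavet_property_linf_sum (R : realType) (I : choiceType)
    (K : I -> topologicalType) (cK : forall i, compact [set: K i])
    (B : topologicalType) (cB : compact [set: B]) (e : {i & K i} -> B)
    (eB : cech_stone_compactification e) (k : Type) :
  daugavet_property (linf_sum (fun i => contfun R (cK i))) k <->
  daugavet_property (contfun R cB) k.
Proof.
have ce := cech_stone_continuous eB; have [_ _ _ De _] := eB.
pose phi : {linear contfun R cB -> linf_sum (fun i => contfun R (cK i))} :=
  restrict_linf cK ce.
have phiN G : `|phi G| = `|G| by exact: norm_restrict_linf.
have phiS g : exists G, phi G = g.
  have [|[i p]|G cG Ge] := @cech_stone_extension R _ _ _ eB
      (fun x => g (projT1 x) (projT2 x)) `|g|.
  - by apply: (@sigT_continuous _ _ _ (fun i => g i : K i -> R)) => i; exact: contfun_continuous.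
  - apply: le_trans (le_contfun_norm (g i) p) _.
    exact: (@le_supnorm _ _ _ _ i (linf_bounded g)).
  exists (ContFun cB cG); apply: linf_sumP => i; apply: contfunP.
  by apply/funext => p; exact: Ge.
have [psi [psiN psiK]] := linear_isometry_inverse phiN phiS.
split; last exact: daugavet_property_isometry phiN phiS.
by apply: (daugavet_property_isometry psiN) => G; exists (phi G).
Qed.

Theorem proposition5p5 (R : realType) (I : choiceType)
    (K : I -> topologicalType)
    (cK : forall i, compact [set: K i]) (hK : forall i, hausdorff_space (K i))
    (B : topologicalType) (e : {i & K i} -> B)
    (eB : cech_stone_compactification e) :
  reaping_number B = min_card (fun i => reaping_number (K i)) /\
  daugavet_number (linf_sum (fun i => contfun R (cK i))) =
    min_card (fun i => daugavet_number (contfun R (cK i))).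
Proof.
have minE : least_card (reapable B) = min_card (fun i => least_card (reapable (K i))).
  rewrite min_card_least_card; last by move=> i k k'; exact: reapable_card_eq.
  by apply: eq_least_card => k; exact: (reapable_cech_stone R cK hK eB k).
(* The Daugavet number of [C(L)] is thus the reaping number of [L], which turns the second equality
   into the first. *)
have dauE (L : topologicalType) (cL : compact [set: L]) : hausdorff_space L ->
    daugavet_number (contfun R cL) = least_card (reapable L).
  move=> hL; apply: eq_least_card => k.
  by rewrite daugavet_property_contfun// notK.
split.
  by rewrite reaping_numberE minE; congr min_card; apply/funext => i; rewrite reaping_numberE.
have [cB hB _ _ _] := eB.
transitivity (daugavet_number (contfun R cB)).
  by apply: eq_least_card => k; rewrite (@daugavet_property_linf_sum R I K cK B cB e eB).
by rewrite dauE// minE; congr min_card; apply/funext => i; rewrite dauE.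
Qed.
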